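(* Let $N\ge2$ be an integer and let $m_0:\mathbb{T}\to\mathbb{C}$ be Lipschitz with finitely many zeros and satisfy $\frac1N\sum_{w^N=z}|m_0(w)|^2=1$ for all $z\in\mathbb{T}$. Let $\nu$ be the Perron–Frobenius measure of $m_0$ (see context). Then exactly one of the following holds: (i) The support of $\nu$ is $\mathbb{T}$. (ii) $\nu$ is atomic and the support of $\nu$ is a union of cycles $C=\{z_1,\dots,z_p\}\subset\mathbb{T}$ with $z_1^N=z_2,\dots,z_{p-1}^N=z_p$, $z_p^N=z_1$, and $|m_0(z_i)|^2=N$ for all $i\in\{1,\dots,p\}$.
   Context: $\mu$ is normalized Haar measure on the circle $\mathbb{T}$. The Ruelle operator is $(Rf)(z)=\frac1N\sum_{w^N=z}|m_0(w)|^2f(w)$. The Perron–Frobenius measure $\nu$ is the Borel probability measure given by the limit $\int f\,d\nu=\lim_{n\to\infty}\frac1n\sum_{k=0}^{n-1}\int_{\mathbb{T}}R^kf\,d\mu$, $f\in C(\mathbb{T})$ (which exists for Lipschitz $m_0$); it satisfies $\int Rf\,d\nu=\int f\,d\nu$ for all $f\in C(\mathbb{T})$. The support of $\nu$ means its closed (distributional) support: the complement of the union of the open sets of $\nu$-measure zero. *)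

(* Defs.v *)
From HB Require Import structures.
From mathcomp Require Import all_boot all_order all_algebra.
From mathcomp Require Import complex.
From mathcomp Require Import all_classical all_reals all_analysis.
Import Order.TTheory GRing.Theory Num.Theory.
Import numFieldNormedType.Exports Normc.

Set Implicit Arguments.
Unset Strict Implicit.
Unset Printing Implicit Defensive.

Local Open Scope classical_set_scope.
Local Open Scope ring_scope.
Local Open Scope complex_scope.

(** Moduli are taken with [normc : R[i] -> R]: the library norm [`| z |] of a
    complex number is itself an element of [R[i]]. *)
Record circle (R : realType) := Circle {
  circle_val :> R[i];
  circle_norm : normc circle_val == 1
}.

Section circle_group.
Variable R : realType.
Local Notation T := (circle R).

HB.instance Definition _ := [isSub for @circle_val R].
HB.instance Definition _ := [Choice of T by <:].

Fact circle_one_subproof : normc (1 : R[i]) == 1.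
Proof. by rewrite normc1. Qed.

Fact circle_mul_subproof (z w : T) : normc ((z : R[i]) * (w : R[i])) == 1.
Proof. by rewrite normcM !(eqP (circle_norm _)) mulr1. Qed.

Fact circle_inv_subproof (z : T) : normc ((z : R[i])^-1) == 1.
Proof. by rewrite normcV (eqP (circle_norm _)) invr1. Qed.

Definition circle_one : T := Circle circle_one_subproof.
Definition circle_mul (z w : T) : T := Circle (circle_mul_subproof z w).
Definition circle_inv (z : T) : T := Circle (circle_inv_subproof z).

Fact circle_neq0 (z : T) : (z : R[i]) != 0.
Proof.
apply/eqP => z0; have := circle_norm z.
by rewrite z0 normc0 eq_sym oner_eq0.
Qed.

Fact circle_mulA : associative circle_mul.
Proof. by move=> x y z; apply: val_inj; rewrite /= mulrA. Qed.
Fact circle_mul1 : left_id circle_one circle_mul.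
Proof. by move=> x; apply: val_inj; rewrite /= mul1r. Qed.
Fact circle_mulr1 : right_id circle_one circle_mul.
Proof. by move=> x; apply: val_inj; rewrite /= mulr1. Qed.
Fact circle_mulV : left_inverse circle_one circle_inv circle_mul.
Proof. by move=> x; apply: val_inj; rewrite /= mulVf ?circle_neq0. Qed.
Fact circle_mulrV : right_inverse circle_one circle_inv circle_mul.
Proof. by move=> x; apply: val_inj; rewrite /= mulfV ?circle_neq0. Qed.

HB.instance Definition _ := isGroup.Build T
  circle_mulA circle_mul1 circle_mulr1 circle_mulV circle_mulrV.

Lemma circle_valX (z : T) n : circle_val (z ^+ n)%g = (z : R[i]) ^+ n.
Proof.
elim: n => [|n IHn]; first by rewrite expr0.
by rewrite expgS exprS -IHn.
Qed.

(** Subspace topology from [R[i]], and its Borel sigma-algebra. *)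
HB.instance Definition _ := isPointed.Build T circle_one.
HB.instance Definition _ := Topological.copy T
  (initial_topology (fun z : T => (z : (R[i] : numFieldType)))).
HB.instance Definition _ := Measurable.copy T
  (g_sigma_algebraType (@open T)).

End circle_group.

Section ruelle.
Variable R : realType.
Local Notation T := (circle R).

Definition circle_lipschitz (m0 : T -> R[i]) :=
  exists L : R, forall z w : T,
    normc (m0 z - m0 w) <= L * normc ((z : R[i]) - (w : R[i])).

(** Normalized Haar measure: the rotation-invariant Borel probability. *)
Definition haar (mu : probability T R) :=
  forall (w : T) (A : set T), measurable A ->
    mu [set (w * z)%g | z in A] = mu A.

Definition ruelle (N : nat) (m0 : T -> R[i]) (f : T -> R) : T -> R :=
  fun z => N%:R^-1 *
    \sum_(w \in [set w : T | (w ^+ N)%g = z]) normc (m0 w) ^+ 2 * f w.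

(** Real-valued test functions suffice: [ruelle] and the integrals are linear,
    and a complex function is handled by its real and imaginary parts. *)
Definition perron_frobenius (N : nat) (m0 : T -> R[i])
    (mu nu : probability T R) :=
  forall f : T -> R, continuous f ->
    (fun n : nat => n%:R^-1 *
       \sum_(0 <= k < n) \int[mu]_z iter k (ruelle N m0) f z) @ \oo
    --> \int[nu]_z f z.

Definition msupport (nu : set T -> \bar R) : set T :=
  ~` \bigcup_(U in [set U : set T | open U /\ nu U = 0%E]) U.

(** [nu] is the sum of its point masses. *)
Definition atomic (nu : set T -> \bar R) :=
  forall A : set T, measurable A -> nu A = (\esum_(z in A) nu [set z])%E.

(** [fcycle] on [:: z_1; ...; z_p] says z_i^N = z_(i+1) for i < p and
    z_p^N = z_1. *)
Definition extremal_cycle (N : nat) (m0 : T -> R[i]) (C : set T) :=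
  exists s : seq T,
    [/\ s != [::], C = [set` s], fcycle (fun z : T => (z ^+ N)%g) s
      & forall z, z \in s -> normc (m0 z) ^+ 2 = N%:R].

End ruelle.

(* Main.v *)
Require Import Defs.
From mathcomp Require Import all_boot all_order all_algebra.
From mathcomp Require Import complex.
From mathcomp Require Import all_classical all_reals all_analysis.
From mathcomp Require Import measurable_realfun ring lra.
Import Order.TTheory GRing.Theory Num.Theory.
Import numFieldNormedType.Exports Normc.

Set Implicit Arguments.
Unset Strict Implicit.
Unset Printing Implicit Defensive.

Local Open Scope classical_set_scope.
Local Open Scope ring_scope.
Local Open Scope complex_scope.

(** Write sigma z = z^N, and let S be the support of nu.

    The support is backward invariant away from the zeros of m0: if sigma w
    lies in S and m0 w <> 0, then w lies in S. For otherwise a multiple f of a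
    small tent at w has nu-integral 0, while the Ruelle operator R carries it
    to a function dominating some tent g at sigma w; here sigma must be open at
    w, which is read off the factorization of w^N - z over the N-th roots of z
    ([near_root]). From R^k g <= R^(k+1) f, the Cesaro means defining nu give
    that g has nu-integral at most that of f, that is 0, so sigma w is not in S
    ([msupport_backward]).

    Equivalently, sigma maps the complement U of S into itself, except at
    finitely many points. If U is nonempty it contains a small disc, and some
    iterate of sigma maps that disc onto the whole circle because the N^n-th
    roots of a point become dense uniformly ([dense_preimages]). So the circle
    is covered by U and finitely many exceptional points, and S is finite
    ([backward_invariant_finite]).

    A finite backward invariant S consists of extremal cycles
    ([finite_backward_invariant_cycles]). Since the weights |m0 w|^2 / N over
    the N-th roots w of a point add up to 1, each point of S has a preimage of
    positive weight, which lies in S; so sigma maps S onto a set containing S,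
    and by counting it permutes S. Then every point of S has only one preimage
    in S, hence only one preimage of positive weight, and that weight is 1.
    Finally nu is atomic, as the support of a Borel measure on the circle
    carries all its mass ([measure_setC_msupport]).

    The two cases exclude each other, since not all points of the circle have
    weight 1: sigma would be injective, and so would its iterates, whereas
    roots of unity are dense ([exists_nonextremal]). *)

(** * The chordal distance on the circle *)

Section CircleMetric.
Variable R : realType.
Local Notation T := (circle R).
Implicit Types z w u v : T.

Definition dist z w : R := normc ((z : R[i]) - (w : R[i])).

Lemma distxx z : dist z z = 0.
Proof. by rewrite /dist subrr normc0. Qed.

Lemma normc_ge0 (x : R[i]) : 0 <= normc x.
Proof. by case: x => a b; rewrite /= sqrtr_ge0. Qed.

Lemma normr_normc (x : R[i]) : `|x| = (normc x)%:C.
Proof. by []. Qed.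

Lemma dist_ge0 z w : 0 <= dist z w.
Proof. exact: normc_ge0. Qed.

Lemma distC z w : dist z w = dist w z.
Proof. by rewrite /dist -opprB normcN. Qed.

Lemma dist0_eq z w : dist z w = 0 -> z = w.
Proof. by move=> /eq0_normc /eqP; rewrite subr_eq0 => /eqP /val_inj. Qed.

Lemma dist_triangle u v w : dist u w <= dist u v + dist v w.
Proof.
by rewrite /dist -(subrKA (v : R[i])); exact: le_normcD.
Qed.

Lemma dist_mul u z w : dist (u * z)%g (u * w)%g = dist z w.
Proof. by rewrite /dist /= -mulrBr normcM (eqP (circle_norm u)) mul1r. Qed.

Lemma nbhs_circleP u (A : set T) :
  nbhs u A <-> exists2 r : R, 0 < r & forall v, dist v u < r -> A v.
Proof.
rewrite nbhsE /=; split.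
- case=> U [[V oV <-] /= Vu] UA.
  have /nbhs_ballP[e /= e0 eV] :
      nbhs (u : (R[i] : numFieldType)) V by apply: open_nbhs_nbhs.
  have [r r0 er] : exists2 r : R, 0 < r & e = r%:C.
    exists (complex.Re e); first by move: e0; rewrite ltcE /= => /andP[].
    by move: e0; rewrite ltcE /= => /andP[/eqP]; case: (e) => a b /= ->.
  exists r => // v vr; apply: UA => /=; apply: eV.
  by rewrite /ball /= er normr_normc ltcR -/(dist u v) distC.
- case=> r r0 rA.
  exists [set v | dist v u < r] => //; split; last by rewrite /= distxx.
  exists (ball (u : (R[i] : numFieldType)) r%:C).
    by apply: ball_open; rewrite ltcR.
  apply/seteqP; split=> v; rewrite /ball /= normr_normc ltcR.
    by rewrite -/(dist u v) distC.
  by rewrite -/(dist u v) distC.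
Qed.

Lemma open_ball_circle u (r : R) : open [set v | dist v u < r].
Proof.
rewrite openE => v /= vu; rewrite /interior; apply/nbhs_circleP.
exists (r - dist v u); first by rewrite subr_gt0.
move=> x /= xv; apply: le_lt_trans (dist_triangle x v u) _.
by rewrite addrC -ltrBrDl.
Qed.

Lemma lipschitz_continuous_circle (f : T -> R) (K : R) :
  (forall z w, `|f z - f w| <= K * dist z w) -> continuous f.
Proof.
move=> fK z; apply/(@cvgrPdist_lt _ _ _ _ (nbhs_filter z)) => e e0.
apply/nbhs_circleP.
have K0 : 0 < `|K| + 1 by rewrite ltr_wpDl.
exists (e / (`|K| + 1)); first by rewrite divr_gt0.
move=> w; rewrite ltr_pdivlMr // => wz; apply: le_lt_trans (fK _ _) _.
apply: le_lt_trans wz; rewrite mulrC [dist w z]distC ler_wpM2l ?dist_ge0 //.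
by rewrite (le_trans (ler_norm _)) ?lerDl.
Qed.

Lemma lipschitz_dist u z w : `|dist z u - dist w u| <= dist z w.
Proof.
rewrite ler_norml; have := dist_triangle z w u.
have := dist_triangle w z u; rewrite [dist w z]distC => h1 h2.
by apply/andP; split; lra.
Qed.

Definition tent u (r : R) z : R := Num.max 0 (r - dist z u).

Lemma tent_ge0 u r z : 0 <= tent u r z.
Proof. by rewrite /tent le_max lexx. Qed.

Lemma tent_le u (r : R) z : 0 <= r -> tent u r z <= r.
Proof. by move=> r0; rewrite /tent ge_max r0 gerBl dist_ge0. Qed.

Lemma tent_eq0 u (r : R) z : r <= dist z u -> tent u r z = 0.
Proof. by move=> h; apply/max_idPl; rewrite subr_le0. Qed.

Lemma tent_gt0 u (r : R) z : dist z u < r -> 0 < tent u r z.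
Proof. by move=> h; rewrite /tent lt_max subr_gt0 h orbT. Qed.

Lemma le_tent u (r : R) z : r - dist z u <= tent u r z.
Proof. by rewrite /tent le_max lexx orbT. Qed.

Lemma lipschitz_tent u r z w : `|tent u r z - tent u r w| <= dist z w.
Proof.
have := lipschitz_dist u z w; rewrite /tent !ler_norml => /andP[h1 h2].
have := dist_ge0 z w.
by case: (lerP (r - dist z u)); case: (lerP (r - dist w u)); lra.
Qed.

Lemma open_measurable_circle (A : set T) : open A -> measurable A.
Proof. by move=> oA; apply: sub_sigma_algebra. Qed.

Lemma continuous_measurable_circle (f : T -> R) :
  continuous f -> measurable_fun setT f.
Proof.
move=> cf; apply: (measurability _ (RGenOpens.measurableE R)).
move=> _ [_ [a [b ->] <-]]; rewrite setTI; apply: open_measurable_circle.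
by apply: open_comp => // x _; exact: cf.
Qed.

Lemma closed_point u : closed [set u].
Proof.
rewrite -openC openE => v /= vu; apply/nbhs_circleP.
exists (dist v u).
  rewrite lt_neqAle dist_ge0 andbT eq_sym; apply/eqP => /dist0_eq.
  exact: vu.
by move=> w + wu; rewrite wu distC ltxx.
Qed.

Lemma measurable_point u : measurable [set u].
Proof.
rewrite -[X in measurable X]setCK; apply: measurableC.
by apply: open_measurable_circle; rewrite openC; exact: closed_point.
Qed.

End CircleMetric.

(** * Roots on the circle *)

Section Roots.
Variable R : realType.
Local Notation T := (circle R).

Lemma normcX (x : R[i]) n : normc (x ^+ n) = normc x ^+ n.
Proof.
by elim: n => [|n IH]; rewrite ?expr0 ?normc1 // !exprS normcM IH.
Qed.

Lemma normc_prod (I : Type) (s : seq I) (F : I -> R[i]) :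
  normc (\prod_(i <- s) F i) = \prod_(i <- s) normc (F i).
Proof. exact: (big_morph _ (@normcM R) (@normc1 R)). Qed.

(** The complex roots of X^n - z all have modulus 1, so the factorization of
    this polynomial takes place over points of the circle; taking moduli turns
    it into a formula for the distance from w^n to z. *)
Lemma root_factorization n (z : T) : (0 < n)%N ->
  exists s : seq T, [/\ size s = n,
    forall u, (u ^+ n)%g = z <-> u \in s &
    forall w, dist (w ^+ n)%g z = \prod_(u <- s) dist w u].
Proof.
move=> n0.
have [rs prs] := closed_field_poly_normal ('X^n - (z : R[i])%:P).
have lc : lead_coef ('X^n - (z : R[i])%:P) = 1.
  by apply/eqP; rewrite -monicE monicXnsubC.
rewrite lc scale1r in prs.
have rootE x : (x \in rs) = (x ^+ n == (z : R[i])).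
  by rewrite -root_prod_XsubC -prs /root !hornerE subr_eq0.
have rs1 x : x \in rs -> normc x == 1.
  rewrite rootE => /eqP h; have := circle_norm z; rewrite -h normcX.
  by rewrite pexpr_eq1 ?normc_ge0 // lt0n_neq0 //.
have [s sE] : exists s : seq T, map (@circle_val R) s = rs.
  elim: (rs) rs1 => [|x r IH] h; first by exists [::].
  have [|s <-] := IH; first by move=> y yr; apply: h; rewrite inE yr orbT.
  exists (Circle (h x (mem_head _ _)) :: s) => //.
exists s; split.
- have : size ('X^n - (z : R[i])%:P) = n.+1 by rewrite size_XnsubC.
  by rewrite prs size_prod_XsubC -sE size_map => -[].
- move=> u; have -> : u \in s = (circle_val u \in rs).
    by rewrite -sE mem_map //; exact: val_inj.
  rewrite rootE -circle_valX; split => [->//|/eqP]; exact: val_inj.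
- move=> w; rewrite /dist circle_valX.
  have -> : (w : R[i]) ^+ n - (z : R[i]) = ('X^n - (z : R[i])%:P).[w : R[i]].
    by rewrite !hornerE.
  rewrite prs -sE big_map horner_prod normc_prod.
  by apply: eq_bigr => u _; rewrite !hornerE.
Qed.

Lemma finite_roots n (z : T) : (0 < n)%N ->
  finite_set [set w : T | (w ^+ n)%g = z].
Proof.
move=> n0; have [s [_ sE _]] := root_factorization z n0.
rewrite (_ : [set _ | _] = [set` s]) //; apply/seteqP.
by split=> u /=; [move/sE | move/sE].
Qed.

(** By the product formula of [root_factorization], w cannot be at distance c
    or more from all n-th roots of z. This is a quantitative openness of the
    n-th power map. *)
Lemma near_root n (w z : T) (c : R) : (0 < n)%N -> 0 <= c ->
  dist (w ^+ n)%g z < c ^+ n -> exists2 u, (u ^+ n)%g = z & dist w u < c.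
Proof.
move=> n0 c0; have [s [<- sE ->]] := root_factorization z n0.
move=> lt_c; apply: contrapT => far.
suff : c ^+ size s <= \prod_(u <- s) dist w u by rewrite leNgt lt_c.
have {far} : forall u, u \in s -> c <= dist w u.
  move=> u us; rewrite leNgt; apply/negP => uc.
  by apply: far; exists u => //; exact/sE.
elim: (s) => [|u t IH] far; first by rewrite big_nil.
rewrite big_cons exprS ler_pM ?exprn_ge0 ?far ?mem_head //.
by apply: IH => v vt; rewrite far // inE vt orbT.
Qed.

Definition cis (t : R) : R[i] := (cos t +i* sin t)%C.

Fact cis_norm t : normc (cis t) == 1.
Proof. by rewrite /= cos2Dsin2 sqrtr1. Qed.

Definition expi t : T := Circle (cis_norm t).

Lemma expiD s t : expi (s + t) = (expi s * expi t)%g.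
Proof.
apply: val_inj => /=; rewrite /cis cosD sinD.
by congr (_ +i* _)%C; rewrite addrC // mulrC.
Qed.

Lemma expi0 : expi 0 = 1%g.
Proof. by apply: val_inj; rewrite /= /cis cos0 sin0. Qed.

Lemma expi_muln n t : expi (n%:R * t) = (expi t ^+ n)%g.
Proof.
elim: n => [|n IH]; first by rewrite mul0r expi0.
by rewrite expgS -IH -expiD -nat1r mulrDl mul1r.
Qed.

Lemma expi_2pi : expi (pi *+ 2) = 1%g.
Proof. by apply: val_inj; rewrite /= /cis cos2pi sin2pi. Qed.

Lemma expi_surj (z : T) : exists2 t : R, 0 <= t & expi t = z.
Proof.
case: z => -[a b] /= nz.
have ab : a ^+ 2 + b ^+ 2 = 1.
  by rewrite -[LHS]sqr_sqrtr ?addr_ge0 ?sqr_ge0 // (eqP nz) expr1n.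
have a1 : -1 <= a <= 1.
  rewrite -ler_norml -(@ler_pXn2r _ 2) ?nnegrE // expr1n.
  rewrite real_normK ?num_real //.
  by rewrite -ab lerDl sqr_ge0.
have cosa : cos (acos a) = a by apply: acosK; rewrite in_itv.
have sina : sin (acos a) = `|b|.
  by rewrite sin_acos // -ab addrAC subrr add0r sqrtr_sqr.
(* The arc cosine covers the upper half circle; reflecting it covers the
   lower half, and the period keeps the argument nonnegative. *)
have [b0|b0] := lerP 0 b.
  exists (acos a); first exact: acos_ge0.
  by apply: val_inj; rewrite /= /cis cosa sina ger0_norm.
exists (- acos a + pi *+ 2).
  by have := acos_lepi a1; have := pi_ge0 R; rewrite mulr2n; lra.
apply: val_inj; rewrite /= /cis cosD2pi sinD2pi cosN sinN cosa sina.
by rewrite ltr0_norm // opprK.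
Qed.

Lemma expi_near1 (e : R) : 0 < e -> exists2 d : R, 0 < d &
  forall t, `|t| < d -> dist (expi t) 1%g < e.
Proof.
move=> e0; have e20 : 0 < e ^+ 2 / 2 by rewrite divr_gt0 ?exprn_gt0.
have /cvgrPdist_lt/(_ _ e20)/nbhs_ballP[d /= d0 dP] := @continuous_cos R 0.
exists d => // t td.
have := dP t; rewrite /ball /= sub0r normrN cos0 => /(_ td) /ltr_normlP[_ h].
(* The squared chord from 1 to expi t is 2 - 2 cos t, whence the bound
   e^2 / 2 on 1 - cos t. *)
rewrite /dist /cis /= -(@ltr_pXn2r _ 2) ?nnegrE ?sqrtr_ge0 ?ltW //.
rewrite sqr_sqrtr ?addr_ge0 ?sqr_ge0 // subr0.
have := cos2Dsin2 t; nra.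
Qed.

Definition unity_root (n : nat) : T := expi (pi *+ 2 / n%:R).

Lemma unity_rootX n : (0 < n)%N -> (unity_root n ^+ n)%g = 1%g.
Proof.
move=> n0; rewrite -expi_muln mulrC divfK ?expi_2pi //.
by rewrite pnatr_eq0 -lt0n.
Qed.

(** Successive N^n-th roots of unity are 2 pi / N^n apart in argument, so with
    x = expi t the power to take is the integer part of t N^n / (2 pi). The
    exponent n depends on e alone, not on x. *)
Lemma dense_unity_roots N (e : R) : (2 <= N)%N -> 0 < e -> exists n,
  forall x : T, exists k, dist (unity_root (N ^ n) ^+ k)%g x < e.
Proof.
move=> N2 e0; have [d d0 dP] := expi_near1 e0.
have p0 : 0 < (pi *+ 2 : R) by rewrite pmulrn_lgt0 ?pi_gt0.
exists (Num.truncn (pi *+ 2 / d)).+1 => x.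
set M := (N ^ _)%N.
have M0 : 0 < M%:R :> R by rewrite ltr0n expn_gt0; case: N N2 {M}.
have Md : pi *+ 2 / M%:R < d.
  rewrite ltr_pdivrMr // mulrC -ltr_pdivrMr //.
  apply: lt_trans (truncnS_gt _) _.
  by rewrite ltr_nat ltn_expl.
have [t t0 <-] := expi_surj x.
pose s : R := pi *+ 2 / M%:R; have s0 : 0 < s by rewrite divr_gt0.
have /truncn_itv/andP[k1 k2] : 0 <= t / s by rewrite divr_ge0 // ltW.
exists (Num.truncn (t / s)); rewrite /unity_root -/s -expi_muln.
set k := (Num.truncn _)%:R in k1 *.
have -> : t = k * s + (t - k * s) by rewrite addrC subrK.
rewrite expiD -[X in dist X _]mulg1 dist_mul distC; apply: dP.
rewrite ler_pdivlMr // in k1.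
rewrite ltr_pdivrMr // -natr1 mulrDl mul1r -/k in k2.
by rewrite ger0_norm ?subr_ge0 // -/s ltrBlDl (lt_trans k2) // ltrD2l.
Qed.

Lemma circle_mulC (z w : T) : (z * w)%g = (w * z)%g.
Proof. by apply: val_inj; rewrite /= mulrC. Qed.

(** Fix one N^n-th root r of z; the others are the products of r with roots of
    unity, and multiplication by r is an isometry. *)
Lemma dense_preimages N (e : R) : (2 <= N)%N -> 0 < e -> exists n,
  forall u z : T, exists2 w, (w ^+ (N ^ n))%g = z & dist w u < e.
Proof.
move=> N2 e0; have [n nP] := dense_unity_roots N2 e0.
exists n => u z; set M := (N ^ n)%N in nP *.
have M0 : (0 < M)%N by rewrite expn_gt0; case: N N2 {nP M}.
have [t _ <-] := expi_surj z; pose r := expi (t / M%:R).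
have [k kP] := nP (r^-1 * u)%g.
exists (r * unity_root M ^+ k)%g.
  rewrite expgMn; last exact: circle_mulC.
  rewrite -expi_muln mulrC divfK ?pnatr_eq0 -?lt0n //.
  by rewrite expgnAC unity_rootX // expg1n mulg1.
by rewrite -[X in dist _ X](mulVKg r) dist_mul.
Qed.

End Roots.

(** * Integrals of bounded functions on the circle *)

Section Integral.
Variables (R : realType) (P : probability (circle R) R).
Local Notation T := (circle R).

(** The integral of a nonnegative function is the supremum of the integrals of
    the simple functions below it, so it is monotone on arbitrary functions.
    In this form it applies directly to the iterates of the Ruelle operator.
    The bound M keeps [fine] from sending an
    infinite integral to 0. *)
Lemma le_Rintegral_bounded (f g : T -> R) (M : R) :
  (forall x, 0 <= f x <= g x) -> (forall x, g x <= M) ->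
  \int[P]_x f x <= \int[P]_x g x.
Proof.
move=> fg gM.
have f0 x : (0 <= (f x)%:E)%E by rewrite lee_fin; case/andP: (fg x).
have g0 x : (0 <= (g x)%:E)%E.
  by rewrite lee_fin; case/andP: (fg x); exact: le_trans.
have le_int (h k : T -> \bar R) : (forall x, 0 <= h x)%E ->
    (forall x, h x <= k x)%E -> (\int[P]_x h x <= \int[P]_x k x)%E.
  move=> h0 hk; have k0 x : (0 <= k x)%E by exact: le_trans (h0 x) (hk x).
  rewrite !ge0_integralTE //; apply: le_ereal_sup => _ [s /= sh <-].
  by exists s => // x; exact: le_trans (sh x) (hk x).
have gfin : (\int[P]_x (g x)%:E)%E \is a fin_num.
  rewrite ge0_fin_numE ?integral_ge0 //.
  apply: (@le_lt_trans _ _ (\int[P]_x M%:E)%E).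
    by apply: le_int => // x; rewrite lee_fin.
  by rewrite integral_cst //= probability_setT mule1 ltry.
have le_fg : (\int[P]_x (f x)%:E <= \int[P]_x (g x)%:E)%E.
  by apply: le_int => // x; rewrite lee_fin; case/andP: (fg x).
apply: fine_le => //.
rewrite ge0_fin_numE ?integral_ge0 //.
by apply: le_lt_trans le_fg _; rewrite -ge0_fin_numE ?integral_ge0.
Qed.

Lemma Rintegral_le_bound (f : T -> R) (M : R) :
  (forall x, 0 <= f x <= M) -> \int[P]_x f x <= M.
Proof.
move=> fM; apply: le_trans (@le_Rintegral_bounded f (fun=> M) M fM _) _ => //.
rewrite Rintegral_cst // [X in fine X]probability_setT mulr1 //.
Qed.

Lemma Rintegral_null_support (f : T -> R) (A : set T) :
  continuous f -> (forall x, 0 <= f x) -> measurable A -> P A = 0%E ->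
  (forall x, ~ A x -> f x = 0) -> \int[P]_x f x = 0.
Proof.
move=> cf f0 mA PA fA; rewrite /Rintegral.
have /measurable_EFinP mf := continuous_measurable_circle cf.
have : ae_eq P setT (EFin \o f) (cst 0%E).
  exists A; split => // x /= xf; apply: contrapT => /fA fx.
  by apply: xf; rewrite fx.
move/(ae_eq_integral_abs P measurableT mf).
under eq_integral => x _ do rewrite /= ger0_norm ?f0 //.
by move=> ->.
Qed.

Lemma Rintegral_eq0_null (f : T -> R) (M : R) :
  continuous f -> (forall x, 0 <= f x <= M) -> \int[P]_x f x = 0 ->
  P [set x | 0 < f x] = 0%E.
Proof.
move=> cf fM; rewrite /Rintegral.
have f0 x : 0 <= f x by case/andP: (fM x).
have /measurable_EFinP mf := continuous_measurable_circle cf.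
have ofpos : open [set x | 0 < f x].
  by apply: (open_comp (f := f) (D := [set y | 0 < y])) => // x _; exact: cf.
have fin : (\int[P]_x (f x)%:E)%E \is a fin_num.
  rewrite ge0_fin_numE ?integral_ge0 //; last by move=> x _; rewrite lee_fin.
  apply: (@le_lt_trans _ _ (\int[P]_x M%:E)%E).
    apply: ge0_le_integral => //.
    - by move=> x _; rewrite lee_fin.
    - by move=> x _; rewrite lee_fin; case/andP: (fM x).
  by rewrite integral_cst //= probability_setT mule1 ltry.
move=> /eqP; rewrite fine_eq0 // => /eqP int0.
have [N [mN PN fN]] : ae_eq P setT (EFin \o f) (cst 0%E).
  apply/(ae_eq_integral_abs P measurableT mf).
  by under eq_integral => x _ do rewrite /= ger0_norm ?f0 //.
apply: (subset_measure0 _ mN _ PN); first exact: open_measurable_circle.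
move=> x /= fx; apply: fN => /= /(_ I) [] fx0.
by rewrite fx0 ltxx in fx.
Qed.

End Integral.

(** * The support of a measure on the circle *)

Section Support.
Variables (R : realType) (nu : probability (circle R) R).
Local Notation T := (circle R).

Lemma msupportPn (u : T) : ~ msupport nu u <->
  exists2 r : R, 0 < r & nu [set v | dist v u < r] = 0%E.
Proof.
split.
  move=> /contrapT [U [oU nuU] Uu].
  have /nbhs_circleP[r r0 rU] : nbhs u U by apply: open_nbhs_nbhs.
  exists r => //; apply: (subset_measure0 _ (open_measurable_circle oU) _ nuU).
    by apply: open_measurable_circle; exact: open_ball_circle.
  by move=> v; exact: rU.
case=> r r0 nur; apply; exists [set v | dist v u < r].
  by split => //; exact: open_ball_circle.
by rewrite /= distxx.
Qed.

Lemma closed_msupport : closed (msupport nu).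
Proof. by apply: open_closedC; apply: bigcup_open => U []. Qed.

(** A Lindelof argument: every point outside the support has a null disc around
    it, inside which lies a disc containing that point, centred at a root of
    unity of order a power of 2 and of radius 1/(m+1). There are countably many
    such discs. *)
Lemma measure_setC_msupport : nu (~` msupport nu) = 0%E.
Proof.
have mS : measurable (~` msupport nu).
  by apply: open_measurable_circle; apply: closed_openC; exact: closed_msupport.
pose B n k m := [set v : T | dist v (unity_root R (2 ^ n) ^+ k)%g < m.+1%:R^-1].
pose A n k m := if nu (B n k m) == 0%E then B n k m else set0.
have A0 n k m : nu.-negligible (A n k m).
  rewrite /A; case: ifPn => [/eqP nuB|_]; last exact: negligible_set0.
  exists (B n k m); split => //.
  by apply: open_measurable_circle; exact: open_ball_circle.
have /(negligibleP _ _)/= : nu.-negligible (~` msupport nu); last exact.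
apply: (@negligibleS _ _ _ _ (\bigcup_n \bigcup_k \bigcup_m A n k m)); last first.
  apply: negligible_bigcup => n; apply: negligible_bigcup => k.
  exact: negligible_bigcup.
move=> u /msupportPn[r r0 nur].
(* The radius is below r / 2, so that a disc of this radius containing u
   lies within r of u. *)
pose m := Num.truncn (2 / r).
have mr : m.+1%:R^-1 < r / 2.
  rewrite invf_plt ?posrE ?divr_gt0 // invf_div.
  exact: truncnS_gt.
have m0 : 0 < m.+1%:R^-1 :> R by rewrite invr_gt0.
have [n nP] := @dense_unity_roots R 2 _ isT m0.
have [k ku] := nP u.
exists n => //; exists k => //; exists m => //; rewrite /A.
rewrite ifT; first by rewrite /B /= distC.
apply/eqP; apply: (subset_measure0 _ _ _ nur).
- by apply: open_measurable_circle; exact: open_ball_circle.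
- by apply: open_measurable_circle; exact: open_ball_circle.
move=> v; rewrite /B /= => vk; apply: le_lt_trans (dist_triangle _ _ _) _.
by apply: lt_trans (ltrD vk ku) _; rewrite [ltRHS]splitr ltrD.
Qed.

Lemma finite_msupport_atomic : finite_set (msupport nu) -> atomic nu.
Proof.
move=> fS A mA; set S := msupport nu in fS *.
have mS : measurable S.
  rewrite -[S]setCK; apply: measurableC; apply: open_measurable_circle.
  by apply: closed_openC; exact: closed_msupport.
have null B : measurable B -> B `<=` ~` S -> nu B = 0%E.
  move=> mB BS; apply: (subset_measure0 mB (measurableC mS) BS).
  exact: measure_setC_msupport.
have fAS : finite_set (A `&` S) by exact: finite_setIr.
rewrite (esumID S) // [X in (_ + X)%E]esum1 ?adde0; last first.
  move=> z [_ zS]; apply: null; first exact: measurable_point.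
  by move=> _ ->.
rewrite esum_fset // -measure_fin_bigcup //; last 2 first.
- by move=> x y _ _ [z [-> ->]].
- by move=> z _; exact: measurable_point.
rewrite bigcup_imset1 image_id (measureDI _ mA mS) addeC.
rewrite [X in (_ + X)%E]null ?adde0 //; exact: measurableD.
Qed.

End Support.

(** * The Ruelle operator and the support of its Perron-Frobenius measure *)

Section Ruelle.
Variables (R : realType) (N : nat) (m0 : circle R -> R[i]).
Local Notation T := (circle R).
Local Notation Ru := (ruelle N m0).
Hypothesis N0 : (0 < N)%N.
Hypothesis m0_norm : forall z : T,
  N%:R^-1 * \sum_(w \in [set w : T | (w ^+ N)%g = z]) normc (m0 w) ^+ 2 = 1.

Lemma ruelle_le (f g : T -> R) : (forall x, f x <= g x) ->
  forall z, Ru f z <= Ru g z.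
Proof.
move=> fg z; rewrite /ruelle ler_wpM2l ?invr_ge0 ?ler0n //.
rewrite !fsbig_finite; try exact: finite_roots.
by apply: ler_sum => w _; rewrite ler_wpM2l ?sqr_ge0.
Qed.

Lemma ruelle_cst (c : R) z : Ru (fun=> c) z = c.
Proof. by rewrite /ruelle -mulr_fsuml mulrA m0_norm mul1r. Qed.

Lemma ruelle_ge_term (f : T -> R) (w : T) : (forall x, 0 <= f x) ->
  N%:R^-1 * (normc (m0 w) ^+ 2 * f w) <= Ru f (w ^+ N)%g.
Proof.
move=> f0; rewrite /ruelle ler_wpM2l ?invr_ge0 ?ler0n //.
rewrite (fsbigD1 w) /=; last 2 first.
- exact: finite_roots.
- by [].
by rewrite lerDl fsumr_ge0 // => x _; rewrite mulr_ge0 ?sqr_ge0.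
Qed.

Lemma iter_ruelle_le k (f g : T -> R) : (forall x, f x <= g x) ->
  forall z, iter k Ru f z <= iter k Ru g z.
Proof. by move=> fg; elim: k => [|k IH] //= z; exact: ruelle_le. Qed.

Lemma iter_ruelle_cst k (c : R) z : iter k Ru (fun=> c) z = c.
Proof.
elim: k z => [|k IH] //= z.
by rewrite -[RHS](ruelle_cst c z); congr ruelle; apply/funext.
Qed.

Lemma iter_ruelle_bounds k (f : T -> R) (M : R) :
  (forall x, 0 <= f x <= M) -> forall z, 0 <= iter k Ru f z <= M.
Proof.
move=> fM z; rewrite -{1}(iter_ruelle_cst k 0 z) -(iter_ruelle_cst k M z).
by rewrite !iter_ruelle_le // => x; case/andP: (fM x).
Qed.

Variables (mu nu : probability T R).
Hypothesis pf : perron_frobenius N m0 mu nu.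

(** Iterating g <= R f gives R^k g <= R^(k+1) f, so that the n-th Cesaro mean of
    g is at most that of f, up to the integral of R^n f / n, which is at most M / n and
    tends to 0. *)
Lemma perron_frobenius_le (f g : T -> R) (M : R) :
  continuous f -> continuous g -> (forall x, 0 <= f x <= M) ->
  (forall x, 0 <= g x) -> (forall z, g z <= Ru f z) ->
  \int[nu]_z g z <= \int[nu]_z f z.
Proof.
move=> cf cg fM g0 gf.
pose b k := \int[mu]_z iter k Ru f z.
have b_bounds k : 0 <= b k <= M.
  have h := iter_ruelle_bounds k fM.
  rewrite Rintegral_ge0 /=; last by move=> x _; case/andP: (h x).
  exact: Rintegral_le_bound.
have ab k : \int[mu]_z iter k Ru g z <= b k.+1.
  apply: (@le_Rintegral_bounded _ _ _ _ M) => x; last first.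
    by have /andP[] := iter_ruelle_bounds k.+1 fM x.
  rewrite -{1}(iter_ruelle_cst k 0 x) iter_ruelle_le //=.
  by rewrite -iterS iterSr iter_ruelle_le.
have M_cvg : (fun n : nat => n%:R^-1 * M) @ \oo --> (0 : R).
  have h := cvgMr_tmp (b := M) (@cvg_harmonic R).
  by rewrite mul0r in h; rewrite -cvg_shiftS; exact: h.
have lim := cvgD (pf cf) M_cvg; rewrite addr0 in lim.
apply: (ler_cvg_to (pf cg) (lim _)); apply: nearW => n /=.
rewrite /= -mulrDr ler_wpM2l ?invr_ge0 //.
apply: (@le_trans _ _ (\sum_(0 <= k < n) b k.+1)).
  by apply: ler_sum => k _; exact: ab.
have E : b 0%N + \sum_(0 <= k < n) b k.+1 = \sum_(0 <= k < n) b k + b n.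
  by rewrite -big_nat_recl // big_nat_recr.
have /andP[b0 _] := b_bounds 0%N; have /andP[_ bn] := b_bounds n.
rewrite -[X in _ <= X + _]/(\sum_(0 <= k < n) b k); move: E bn b0; lra.
Qed.

(** Contrapositive: a null disc around w yields a null disc around w^N. The
    function f is a multiple of a tent inside the null disc, where |m0| stays
    above |m0 w| / 2, and c is the multiple for which the term of u in R f
    reaches the height d of the tent g whenever u is within eta / 2 of w. The
    radius d = (eta / 2)^N is the one for which [near_root] provides such a u
    above every point where g is positive. *)
Lemma msupport_backward (w : T) : circle_lipschitz m0 -> m0 w <> 0 ->
  msupport nu (w ^+ N)%g -> msupport nu w.
Proof.
move=> [L mL] mw; apply: contraPP => /msupportPn[r r0 nur].
pose K : R := `|L| + 1; have K0 : 0 < K by rewrite ltr_wpDl.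
pose a := normc (m0 w).
have a0 : 0 < a.
  by rewrite lt_neqAle normc_ge0 andbT eq_sym; apply/eqP => /eq0_normc.
have ma u : dist u w < a / 2 / K -> a / 2 <= normc (m0 u).
  rewrite ltr_pdivlMr // => du.
  have : a <= normc (m0 u - m0 w) + normc (m0 u).
    rewrite /a -{1}[m0 w](subrK (m0 u)).
    by apply: le_trans (le_normcD _ _) _; rewrite -normcN opprB.
  have : normc (m0 u - m0 w) <= dist u w * K.
    apply: le_trans (mL u w) _; rewrite mulrC ler_wpM2l ?dist_ge0 // /K.
    by rewrite (le_trans (ler_norm _)) ?lerDl.
  lra.
pose eta := Num.min r (a / 2 / K).
have eta0 : 0 < eta by rewrite lt_min r0 !divr_gt0.
pose d := (eta / 2) ^+ N; have d0 : 0 < d by rewrite exprn_gt0 ?divr_gt0.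
have N0' : 0 < N%:R :> R by rewrite ltr0n.
pose c : R := d / (N%:R^-1 * ((a / 2) ^+ 2 * (eta / 2))).
have c0 : 0 < c by rewrite !(divr_gt0, mulr_gt0, exprn_gt0, invr_gt0).
pose f z := c * tent w eta z.
pose g z := tent (w ^+ N)%g d z.
have fM x : 0 <= f x <= c * eta.
  by rewrite /f mulr_ge0 ?tent_ge0 ?(ltW c0) //= ler_pM2l // tent_le // ltW.
have cg : continuous g.
  apply: (@lipschitz_continuous_circle _ _ 1) => x y.
  by rewrite mul1r lipschitz_tent.
have cf : continuous f.
  apply: (@lipschitz_continuous_circle _ _ c) => x y.
  by rewrite /f -mulrBr normrM (gtr0_norm c0) ler_pM2l // lipschitz_tent.
have f_null : \int[nu]_z f z = 0.
  apply: Rintegral_null_support nur _ => //.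
  - by move=> x; case/andP: (fM x).
  - by apply: open_measurable_circle; exact: open_ball_circle.
  - move=> x /negP; rewrite -leNgt => rx; rewrite /f tent_eq0 ?mulr0 //.
    by rewrite (le_trans _ rx) // ge_min lexx.
have gf z : g z <= Ru f z.
  have f0 x : 0 <= f x by case/andP: (fM x).
  have [dz|zd] := leP d (dist z (w ^+ N)%g).
    rewrite /g tent_eq0 //.
    by rewrite -(ruelle_cst 0 z); apply: ruelle_le.
  apply: (@le_trans _ _ d); first by rewrite tent_le // ltW.
  rewrite distC in zd.
  have [|u uz uw] := near_root N0 _ zd; first by rewrite ltW ?divr_gt0.
  rewrite distC in uw.
  rewrite -uz; apply: le_trans (ruelle_ge_term u f0).
  have -> : d = N%:R^-1 * ((a / 2) ^+ 2 * (c * (eta / 2))).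
    rewrite /c; field.
    by rewrite !gt_eqF.
  have fu : c * (eta / 2) <= f u.
    rewrite /f ler_pM2l //; apply: le_trans (le_tent _ _ _).
    by rewrite lerBrDl; lra.
  have mu' : a / 2 <= normc (m0 u).
    apply: ma; apply: lt_le_trans (_ : eta <= _); last
      by rewrite ge_min lexx orbT.
    by lra.
  rewrite ler_pM2l ?invr_gt0 //; apply: ler_pM => //.
  - by rewrite sqr_ge0.
  - by apply/ltW/mulr_gt0 => //; exact: divr_gt0.
  - by rewrite ler_pXn2r // nnegrE ?normc_ge0 //; apply: ltW; rewrite divr_gt0.
have g0 x : 0 <= g x by exact: tent_ge0.
have g_null : \int[nu]_z g z = 0.
  apply/eqP; rewrite eq_le -{1}f_null (perron_frobenius_le cf cg fM g0 gf) /=.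
  by apply: Rintegral_ge0.
apply/msupportPn; exists d => //.
have -> : [set v | dist v (w ^+ N)%g < d] = [set v | 0 < g v].
  apply/seteqP; split=> v /=; first exact: tent_gt0.
  by apply: contraTT; rewrite -!leNgt => h; rewrite /g tent_eq0.
apply: (Rintegral_eq0_null cg _ g_null (M := d)) => x.
by rewrite g0 tent_le // ltW.
Qed.

End Ruelle.

(** * Self-maps of finite sets *)

Section FiniteInvariant.

(** Counting: the image list has as many entries as s and contains s, so it is a
    permutation of s. *)
Lemma finite_surj_inj (T : choiceType) (f : T -> T) (s : seq T) :
  uniq s -> {subset s <= map f s} ->
  {in s, forall x, f x \in s} /\ {in s &, injective f}.
Proof.
move=> us sf; have szf : (size (map f s) <= size s)%N by rewrite size_map.
have [_ eqf] := uniq_min_size us sf szf.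
have uf := leq_size_uniq us sf szf.
split=> [x xs|x y xs ys fxy]; first by rewrite eqf map_f.
rewrite -[LHS](nth_index x xs) -[RHS](nth_index x ys); congr nth; apply/eqP.
rewrite -(nth_uniq (f x) _ _ uf) ?size_map ?index_mem //.
by rewrite !(nth_map x) ?index_mem // !nth_index // fxy.
Qed.

(** The orbit of x under the permutation of the finite type of entries of s. *)
Lemma fcycle_through (T : choiceType) (f : T -> T) (s : seq T) (x : T) :
  {in s, forall x, f x \in s} -> {in s &, injective f} -> x \in s ->
  exists c : seq T, [/\ x \in c, fcycle f c & {subset c <= s}].
Proof.
move=> fs finj xs.
pose g (y : seq_sub s) : seq_sub s := SeqSub (fs _ (ssvalP y)).
have ginj : injective g.
  by move=> y z [yz]; apply: val_inj; apply: finj yz; exact: ssvalP.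
pose x' : seq_sub s := SeqSub xs.
exists (map val (orbit g x')); split.
- by apply/mapP; exists x' => //; exact: in_orbit.
- rewrite cycle_map; apply: sub_cycle (cycle_orbit ginj x') => y z /=.
  by move=> /eqP <-.
- by move=> _ /mapP[y _ ->]; exact: ssvalP.
Qed.

End FiniteInvariant.

(** * Closed sets that are backward invariant away from the zeros *)

Section Dynamics.
Variables (R : realType) (N : nat) (m0 : circle R -> R[i]).
Local Notation T := (circle R).
Hypothesis N2 : (2 <= N)%N.
Hypothesis m0_norm : forall z : T,
  N%:R^-1 * \sum_(w \in [set w : T | (w ^+ N)%g = z]) normc (m0 w) ^+ 2 = 1.

Let N0 : (0 < N)%N. Proof. exact: ltnW. Qed.
Let N0' : 0 < N%:R :> R. Proof. by rewrite ltr0n. Qed.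

Lemma m0_norm_sum z :
  \sum_(w \in [set w : T | (w ^+ N)%g = z]) normc (m0 w) ^+ 2 = N%:R.
Proof.
apply: (mulfI (lt0r_neq0 (_ : 0 < N%:R^-1 :> R))); first by rewrite invr_gt0.
by rewrite m0_norm mulVf // lt0r_neq0.
Qed.

(** The weights of the preimages of z have a positive sum. *)
Lemma ex_nonzero_preimage z : exists2 w, (w ^+ N)%g = z & m0 w <> 0.
Proof.
have : 0 < \sum_(w \in [set w : T | (w ^+ N)%g = z]) normc (m0 w) ^+ 2.
  by rewrite m0_norm_sum.
case/(fsumr_gt0 [::]) => w wz mw; exists w => // m0w.
by rewrite m0w normc0 expr0n ltxx in mw.
Qed.

(** The condition is imposed only at points of positive weight: a point where m0
    vanishes gives no information on its image, since the Ruelle operator does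
    not see it. *)
Definition backward_invariant (S : set T) :=
  forall w, m0 w <> 0 -> S (w ^+ N)%g -> S w.

(** A point u outside S stays outside S under iteration of the N-th power map,
    unless its orbit passes through a zero of m0. The finite set F n collects
    the first n images of the zeros, so after n steps the image of u is outside
    S or in F n. A disc outside S meets the N^n-th roots of every point, for n
    large; hence S is contained in F n. *)
Lemma backward_invariant_finite (S : set T) :
  finite_set [set z | m0 z = 0] -> backward_invariant S -> closed S ->
  S <> setT -> finite_set S.
Proof.
move=> fZ bS cS SnT.
pose F := fix F n := if n is n'.+1
  then (fun z : T => (z ^+ N)%g) @` (F n' `|` [set z | m0 z = 0]) else set0.
have fF n : finite_set (F n).
  elim: n => [|n IH] /=; first exact: finite_set0.
  by apply: finite_image; rewrite finite_setU.
have orbitF n u : ~ S u -> ~ S (u ^+ (N ^ n))%g \/ F n (u ^+ (N ^ n))%g.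
  move=> Su; elim: n => [|n IH]; first by left; rewrite expn0 expg1.
  rewrite expnSr expgnA /=; set v := (u ^+ (N ^ n))%g in IH *.
  case: IH => [Sv|Fv]; last by right; exists v => //; left.
  have [mv|mv] := pselect (m0 v = 0); first by right; exists v => //; right.
  by left => /(bS _ mv).
have [u Su] : exists u, ~ S u.
  by apply: contrapT => h; apply: SnT; apply/seteqP; split=> // z _;
     apply: contrapT => Sz; apply: h; exists z.
have /nbhs_circleP[r r0 rS] : nbhs u (~` S).
  by apply: open_nbhs_nbhs; split => //; exact: closed_openC.
have [n nP] := @dense_preimages R N r N2 r0.
apply: sub_finite_set (fF n) => z Sz.
have [w wz wu] := nP u z.
by case: (orbitF n w (rS w wu)); rewrite wz.
Qed.

(** Positive-weight preimages show that the N-th power map covers S from S, so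
    it permutes S. Two distinct preimages of a point cannot both lie in S, so
    all the weight above a point of S is concentrated on one preimage. *)
Lemma finite_backward_invariant_cycles (S : set T) :
  finite_set S -> backward_invariant S ->
  forall z, S z -> exists2 C, C z /\ C `<=` S & extremal_cycle N m0 C.
Proof.
move=> fS bS z Sz.
pose s : seq T := finmap.enum_fset (fset_set S).
have sE x : x \in s <-> S x.
  by rewrite /s in_fset_set //; split=> [/set_mem|/mem_set].
have us : uniq s by exact: finmap.fset_uniq.
pose sigma (x : T) := (x ^+ N)%g.
have surj : {subset s <= map sigma s}.
  move=> x /sE Sx; have [w wx mw] := ex_nonzero_preimage x.
  apply/mapP; exists w; last by rewrite /sigma wx.
  by apply/sE/bS => //; rewrite wx.
have [stable inj] := finite_surj_inj us surj.
have weight x : x \in s -> normc (m0 x) ^+ 2 = N%:R.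
  move=> xs; rewrite -(m0_norm_sum (x ^+ N)%g) (fsbigD1 x) //=; last first.
    exact: finite_roots.
  rewrite fsbig1 ?addr0 // => y [yx ynx].
  apply: contrapT => my; apply: ynx => /=.
  apply: inj => //; apply/sE/bS; last by rewrite yx; apply/sE/stable.
  by move=> my0; apply: my; rewrite my0 normc0 expr0n.
have [c [zc cyc cs]] := fcycle_through stable inj ((sE z).2 Sz).
exists [set` c]; first by split=> // x /= /cs /sE.
exists c; split => //; last by move=> x /cs; exact: weight.
by apply/eqP => c0; rewrite c0 in zc.
Qed.

(** If all weights were 1, each point would have a single N-th root, and by
    iteration a single N^n-th root; but 1 has an N^n-th root within distance 1
    of -1, hence different from 1. *)
Lemma exists_nonextremal : exists z, normc (m0 z) ^+ 2 <> N%:R.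
Proof.
apply: contrapT => /forallNP ext.
have {}ext z : normc (m0 z) ^+ 2 = N%:R by apply: contrapT; exact: ext.
have inj : injective (fun w : T => (w ^+ N)%g).
  move=> w v wv; apply: contrapT => wnv.
  have := m0_norm_sum (v ^+ N)%g.
  rewrite (fsbigD1 v) //=; last exact: finite_roots.
  rewrite ext => /eqP; rewrite -subr_eq0 addrAC subrr add0r => /eqP sum0.
  have := pfsumr_eq0 _ _ sum0 (i := w) => /= h.
  have := ext w; rewrite h; last 3 first.
  - by apply: sub_finite_set (finite_roots (v ^+ N)%g N0) => x [].
  - by move=> x _; exact: sqr_ge0.
  - by split=> //; exact: nesym.
  by move=> /esym/eqP; rewrite pnatr_eq0 -leqn0 leqNgt N0.
have injn n : injective (fun w : T => (w ^+ (N ^ n))%g).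
  elim: n => [|n IH] w v; first by rewrite expn0 !expg1.
  by rewrite expnSr !expgnA => /inj/IH.
have [n nP] := @dense_preimages R N 1 N2 ltr01.
have [w w1] := nP (expi pi) 1%g.
have -> : w = 1%g by apply: (injn n); rewrite /= w1 expg1n.
have expi_pi : circle_val (expi pi : T) = - 1.
  by apply/eqP; rewrite eq_complex /= cospi sinpi oppr0 !eqxx.
rewrite /dist expi_pi opprK -mulr2n normcMn normc1 => lt21.
by move: lt21; rewrite mulr2n gtrDl ltr10.
Qed.

End Dynamics.

(** * The dichotomy *)

Theorem theorem5p1 (R : realType) (N : nat) (m0 : circle R -> R[i])
    (mu nu : probability (circle R) R) :
  (2 <= N)%N ->
  circle_lipschitz m0 ->
  finite_set [set z : circle R | m0 z = 0] ->
  (forall z : circle R,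
     N%:R^-1 * \sum_(w \in [set w : circle R | (w ^+ N)%g = z])
                 normc (m0 w) ^+ 2 = 1) ->
  haar mu ->
  perron_frobenius N m0 mu nu ->
  let full := msupport nu = [set: circle R] in
  let cyclic := atomic nu /\
    (exists CC : set (set (circle R)),
       (forall C, CC C -> extremal_cycle N m0 C) /\
       msupport nu = \bigcup_(C in CC) C) in
  (full \/ cyclic) /\ ~ (full /\ cyclic).
Proof.
move=> N2 lip fZ m0_norm _ pf full cyclic.
have back : backward_invariant N m0 (msupport nu).
  by move=> w; exact: (msupport_backward (ltnW N2) m0_norm pf lip).
split.
  have [|nfull] := pselect full; [by left | right].
  have fS := backward_invariant_finite N2 fZ back (@closed_msupport _ nu) nfull.
  split; first exact: finite_msupport_atomic.
  exists [set C | extremal_cycle N m0 C /\ C `<=` msupport nu].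
  split=> [C []//|]; apply/seteqP; split=> [z Sz|z [C [_ CS] /CS]//].
  have [C [Cz CS] eC] := finite_backward_invariant_cycles N2 m0_norm fS back Sz.
  by exists C.
move=> [Sfull [_ [CC [ext SCC]]]].
have [z] := exists_nonextremal N2 m0_norm; apply.
have : msupport nu z by rewrite Sfull.
by rewrite SCC => -[C /ext [s [_ -> _ sE]] /sE].
Qed.
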